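(* Let $\omega\in\{0,1\}^\infty$. The graph $X_\omega$ is generic if and only if the sequence $\omega$ has both infinitely many $0$'s and infinitely many $1$'s.
   Context: $\{0,1\}^{\infty}$ is the set of infinite sequences $x_1x_2\ldots$ with $x_i\in\{0,1\}$. Definition of $X_\omega$. For $\omega=x_1x_2\ldots\in\{0,1\}^\infty$ and $n\ge 1$ put $a_n^{\omega}=\sum_{i=1}^n x_i2^{i-1}-2^{n-1}$. The graph $X_\omega$ is undirected with vertex set $V_\omega=\mathbb{Z}$. Its edges are those of the disjoint union $\coprod_{n\ge 0}E^n_\omega$, where $E^0_\omega=\{(z,z+1):z\in\mathbb{Z}\}$ and, for $n\ge1$, $E^n_\omega=\{(2^nz-a_n^\omega,\,2^n(z+1)-a_n^\omega):z\in\mathbb{Z}\}$; in addition, if there is a vertex not incident to any edge of $\coprod_{n\ge 1}E^n_\omega$ (there is at most one such vertex), a loop is added at that vertex. The graph $X_\omega$ is $4$-regular (a loop counts twice). The ball $B(v,r)$ in a graph $X$ is the subgraph (loops included) induced by the vertices at graph distance at most $r$ from $v$, regarded as a graph pointed at $v$; $B(v,r)$ and $B(u,r)$ are isomorphic as pointed graphs if there is a graph isomorphism $B(v,r)\to B(u,r)$ mapping $v$ to $u$. The $r$-type $\alpha(v,r)$ of a vertex $v$ is the isomorphism class of the pointed graph $B(v,r)$. The graph $X$ is generic if for any two distinct vertices $u,v$ of $X$ there is some $r$ with $\alpha(u,r)\neq\alpha(v,r)$. *)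

(* Defs.v *)
From mathcomp Require Import all_boot all_order all_algebra.
From mathcomp Require Import all_classical.

Set Implicit Arguments.
Unset Strict Implicit.
Unset Printing Implicit Defensive.

Import GRing.Theory.

Local Open Scope classical_set_scope.
Local Open Scope ring_scope.

(* Undirected graphs without parallel edges: a loop at v is [adj v v].  A
   relation is enough for the graphs X_omega, see [level_edge_length]. *)
Record graph := Graph {
  vertex :> Type;
  adj : vertex -> vertex -> Prop;
  adj_sym : forall u v, adj u v -> adj v u }.

Fixpoint walk (G : graph) (n : nat) (u v : G) : Prop :=
  if n is m.+1 then exists w : G, adj u w /\ walk m w v else u = v.

(* No d satisfies this when u and v lie in different components. *)
Definition is_dist (G : graph) (u v : G) (d : nat) : Prop :=
  walk d u v /\ forall m, walk m u v -> (d <= m)%N.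

Definition ball_set (G : graph) (v : G) (r : nat) : set G :=
  [set u | exists2 d, is_dist v u d & (d <= r)%N].

Lemma ball_set_center (G : graph) (v : G) (r : nat) : v \in ball_set v r.
Proof. by rewrite inE; exists 0%N. Qed.

Definition induced (G : graph) (A : set G) : graph :=
  @Graph (set_type A) (fun u v => adj (val u) (val v))
    (fun u v => @adj_sym G (val u) (val v)).

Record pgraph := PGraph { pgraph_graph :> graph; point : pgraph_graph }.

Definition ball (G : graph) (v : G) (r : nat) : pgraph :=
  @PGraph (induced (ball_set v r)) (exist _ v (ball_set_center v r)).

Definition pgraph_iso (P Q : pgraph) : Prop :=
  exists f : P -> Q,
    [/\ bijective f, (forall u v, adj u v <-> adj (f u) (f v))
      & f (point P) = point Q].

(* The isomorphism class of the ball.  It is a plain predicate and not a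
   [set pgraph], which would be a universe inconsistency. *)
Definition rtype (G : graph) (v : G) (r : nat) : pgraph -> Prop :=
  fun P => pgraph_iso P (ball v r).

Definition generic (G : graph) : Prop :=
  forall u v : G, u <> v -> exists r, rtype u r <> rtype v r.

(* The sequence x_1 x_2 ... is encoded as omega : nat -> bool with
   x_(i+1) = omega i; only the values of [offset] at n >= 1 are used. *)
Definition offset (omega : nat -> bool) (n : nat) : int :=
  \sum_(i < n) (omega i)%:R * 2 ^+ i - 2 ^+ n.-1.

Definition level_edge (omega : nat -> bool) (n : nat) (u v : int) : Prop :=
  if n is 0 then exists z : int, u = z /\ v = z + 1
  else exists z : int, u = 2 ^+ n * z - offset omega n /\
                       v = 2 ^+ n * (z + 1) - offset omega n.

(* Hence edges of different levels are never parallel, and none is a loop. *)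
Lemma level_edge_length (omega : nat -> bool) (n : nat) (u v : int) :
  level_edge omega n u v -> v - u = 2 ^+ n.
Proof.
case: n => [|n] /= [z [-> ->]]; first by rewrite addrC addKr expr0.
by move: (offset _ _) => a; rewrite opprB addrA subrK mulrDr mulr1 addrC addKr.
Qed.

Definition covered (omega : nat -> bool) (v : int) : Prop :=
  exists n u, (0 < n)%N /\ (level_edge omega n u v \/ level_edge omega n v u).

Definition X_adj (omega : nat -> bool) (u v : int) : Prop :=
  (exists n, level_edge omega n u v \/ level_edge omega n v u)
  \/ (u = v /\ ~ covered omega v).

Lemma X_adj_sym (omega : nat -> bool) (u v : int) :
  X_adj omega u v -> X_adj omega v u.
Proof.
by case=> [[n [e|e]]|[-> nc]]; [left; exists n; right|left; exists n; left|right].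
Qed.

Definition X (omega : nat -> bool) : graph := Graph (@X_adj_sym omega).

(* Main.v *)
Require Import Defs.
From mathcomp Require Import all_boot all_order all_algebra.
From mathcomp Require Import all_classical.
From mathcomp Require Import zify.

Set Implicit Arguments.
Unset Strict Implicit.
Unset Printing Implicit Defensive.

(** Let A be the 2-adic integer with binary digits omega.  A vertex x such that
    x + A has valuation n is joined to x - 1, x + 1 and to x - 2^(n+1),
    x + 2^(n+1), or to itself when x = - A.  The only triangles are {x, x+1, x+2}
    with x + A odd, so an isomorphism of large pointed balls recognizes the
    edges of length 1 and is of the form x |-> v + e (x - u), e = 1 or -1, near
    the centre.  It then preserves the lengths of all edges near the centre,
    hence the valuations of x + A, which is impossible for u <> v unless A is
    an integer.  Finally A is an integer iff omega is eventually constant. *)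

Local Open Scope classical_set_scope.

(** * Walks, balls and isomorphisms of pointed balls in an arbitrary graph *)

Section LocalIsomorphisms.
Import GRing.Theory.

Lemma walk_rcons (G : graph) m (u x y : G) :
  walk m u x -> adj x y -> walk m.+1 u y.
Proof.
elim: m u => [|m IHm] u /=; first by move=> -> xy; exists y.
by move=> [w [uw wx]] xy; exists w; split => //; exact: IHm.
Qed.

Lemma ball_setP (G : graph) (v : G) r x :
  ball_set v r x <-> exists2 m, (m <= r)%N & walk m v x.
Proof.
split=> [[d [vx _] dr]|[m mr vx]]; first by exists d.
have ex : exists m, `[< walk m v x >] by exists m; apply/asboolP.
case: (ex_minnP ex) => d /asboolP vdx dmin.
exists d; first by split=> // k vkx; apply: dmin; apply/asboolP.
by apply: leq_trans mr; apply: dmin; apply/asboolP.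
Qed.

Lemma ball_set_step (G : graph) (v : G) r x y :
  ball_set v r x -> adj x y -> ball_set v r.+1 y.
Proof.
move=> /ball_setP[m mr vx] xy; apply/ball_setP.
by exists m.+1 => //; exact: walk_rcons xy.
Qed.

Lemma ball_set_le {G : graph} {v : G} {r s x} :
  (r <= s)%N -> ball_set v r x -> ball_set v s x.
Proof. by move=> rs [d vx dr]; exists d => //; exact: leq_trans rs. Qed.

Lemma pgraph_iso_refl P : pgraph_iso P P.
Proof. by exists id; split => //; exists id. Qed.

Lemma pgraph_iso_sym P Q : pgraph_iso P Q -> pgraph_iso Q P.
Proof.
move=> [f [[g fK gK] fadj fp]]; exists g; split; first by exists f.
- by move=> u v; rewrite -{1}(gK u) -{1}(gK v); symmetry; exact: fadj.
- by rewrite -fp fK.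
Qed.

Lemma pgraph_iso_trans P Q T :
  pgraph_iso P Q -> pgraph_iso Q T -> pgraph_iso P T.
Proof.
move=> [f [fb fadj fp]] [g [gb gadj gp]]; exists (g \o f); split.
- exact: bij_comp.
- by move=> u v; split=> [/fadj/gadj|/gadj/fadj].
- by rewrite /= fp.
Qed.

Lemma rtype_eqP (G : graph) (u v : G) r :
  rtype u r = rtype v r <-> pgraph_iso (ball u r) (ball v r).
Proof.
split=> [E|uv].
  have : rtype u r (ball u r) by exact: pgraph_iso_refl.
  by rewrite E.
apply/funext => P; apply/propext; split=> H; apply: pgraph_iso_trans H _ => //.
exact: pgraph_iso_sym.
Qed.

Lemma walk_hom (G : graph) (s : G -> G) m u v :
  (forall x y, adj x y -> adj (s x) (s y)) -> walk m u v -> walk m (s u) (s v).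
Proof.
move=> sadj; elim: m u => [|m IHm] u /=; first by move=> ->.
by move=> [w [uw wv]]; exists (s w); split; [exact: sadj|exact: IHm].
Qed.

(** [s] preserves walks, hence maps balls into balls; being its own inverse, it restricts to an
    isomorphism. *)
Lemma involution_ball_iso (G : graph) (s : G -> G) u r :
  involutive s -> (forall x y, adj x y -> adj (s x) (s y)) ->
  pgraph_iso (ball u r) (ball (s u) r).
Proof.
move=> sK sadj.
have sB v w x : s v = w -> x \in ball_set v r -> s x \in ball_set w r.
  move=> <- /set_mem /ball_setP[m mr vx]; apply/mem_set/ball_setP.
  by exists m => //; exact: walk_hom.
pose f (x : ball u r) : ball (s u) r :=
  exist _ (s (val x)) (sB _ _ _ erefl (valP x)).
pose g (x : ball (s u) r) : ball u r :=
  exist _ (s (val x)) (sB _ _ _ (sK u) (valP x)).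
exists f; split.
- by exists g => x; apply: val_inj => /=; rewrite sK.
- move=> x y /=; split=> [/sadj //|/sadj] /=.
  by rewrite !sK.
- exact: val_inj.
Qed.

(** An isomorphism of balls as a total map on vertices, free of membership proofs. The last clause
    says that [g] does not increase the distance to the centre. *)
Definition ball_map (G : graph) (u v : G) r (g : G -> G) :=
  [/\ g u = v,
      forall x y, ball_set u r x -> ball_set u r y -> g x = g y -> x = y,
      forall x y, ball_set u r x -> ball_set u r y ->
        adj x y <-> adj (g x) (g y),
      forall y, ball_set v r y -> exists2 x, ball_set u r x & g x = y
    & forall n x, (n <= r)%N -> ball_set u n x -> ball_set v n (g x)].

Lemma ball_iso_map (G : graph) (u v : G) r :
  pgraph_iso (ball u r) (ball v r) -> exists g, ball_map u v r g.
Proof.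
move=> [f [[f' fK f'K] fadj fp]].
(* The value outside the ball is arbitrary. *)
pose g x := if pselect (ball_set u r x) is left h
            then val (f (exist _ x (mem_set h))) else x.
have gE x (h : x \in ball_set u r) : g x = val (f (exist _ x h)).
  rewrite /g; case: pselect => [h'|]; last by case; exact: set_mem.
  by congr (val (f _)); exact: val_inj.
have gadj x y : ball_set u r x -> ball_set u r y ->
    adj x y <-> adj (g x) (g y).
  by move=> /mem_set hx /mem_set hy; rewrite (gE x hx) (gE y hy);
    exact: (fadj (exist _ x hx) (exist _ y hy)).
have gu : g u = v.
  by rewrite (gE u (ball_set_center u r)); exact: (congr1 val fp).
(* The bound [k + m <= r] keeps the whole walk in the ball, where [g] preserves adjacency. *)
have gwalk m k x y : (k + m <= r)%N -> ball_set u k x -> walk m x y ->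
    walk m (g x) (g y).
  elim: m k x => [|m IHm] k x /=; first by move=> _ _ ->.
  move=> kmr ux [w [xw wy]]; exists (g w).
  have uw : ball_set u k.+1 w by exact: ball_set_step xw.
  split; last by apply: IHm uw wy; rewrite addSnnS.
  apply/(gadj x w) => //.
    by apply: ball_set_le _ ux; apply: leq_trans kmr; exact: leq_addr.
  by apply: ball_set_le _ uw; apply: leq_trans kmr; rewrite -addSnnS; exact: leq_addr.
exists g; split => //.
- move=> x y /mem_set hx /mem_set hy; rewrite (gE x hx) (gE y hy).
  by move=> /val_inj /(can_inj fK) /(congr1 val).
- move=> y /mem_set hy; pose x := f' (exist _ y hy).
  exists (val x); first exact/set_mem/(valP x).
  rewrite (gE _ (valP x)).
  have -> : exist _ (val x) (valP x) = x by exact: val_inj.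
  by rewrite /x f'K.
- move=> n x nr /ball_setP[m mn ux]; apply/ball_setP; exists m => //.
  rewrite -gu; apply: (gwalk m 0 u x) ux.
    by rewrite add0n; exact: leq_trans nr.
  exact/set_mem/ball_set_center.
Qed.

Definition tri (G : graph) (x y : G) :=
  [/\ x <> y, adj x y & exists z, [/\ z <> x, z <> y, adj x z & adj y z]].

(* In [X omega] the vertices [x] with [x + A] even are exactly those with a
   neighbour, possibly themselves, that does not span a triangle with them. *)
Definition spike (G : graph) (x : G) := exists2 t, adj x t & ~ tri x t.

(** The extra unit of radius makes room for the third vertex of the triangle; for a triangle in the
    image, surjectivity gives a preimage of that vertex. *)
Lemma ball_map_tri (G : graph) (u v : G) r g x y : ball_map u v r.+1 g ->
  ball_set u r x -> ball_set u r.+1 y -> tri x y <-> tri (g x) (g y).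
Proof.
move=> [gu ginj gadj gsurj gball] ux uy.
have ux' := ball_set_le (leqnSn r) ux.
split=> -[xy xay [z [zx zy xz yz]]].
  have uz := ball_set_step ux xz.
  split; [by move/ginj => /(_ ux' uy)|exact/(gadj x y)|].
  exists (g z); split; [by move/ginj => /(_ uz ux')|by move/ginj => /(_ uz uy)| |].
    exact/(gadj x z).
  exact/(gadj y z).
have [w uw wE] := gsurj z (ball_set_step (gball _ _ (leqnSn r) ux) xz).
rewrite -{}wE in zx zy xz yz.
split; [by move=> e; apply: xy; rewrite e|exact/(gadj x y)|].
exists w; split; [by move=> e; apply: zx; rewrite e|by move=> e; apply: zy; rewrite e| |].
  exact/(gadj x w).
exact/(gadj y w).
Qed.

Lemma ball_map_spike (G : graph) (u v : G) r g x : ball_map u v r.+1 g ->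
  ball_set u r x -> spike x -> spike (g x).
Proof.
move=> gP ux [t xt ntri]; have [gu ginj gadj gsurj gball] := gP.
have ut := ball_set_step ux xt.
exists (g t); last by move/(ball_map_tri gP ux ut).
by apply/(gadj x t) => //; exact: ball_set_le (leqnSn r) ux.
Qed.

End LocalIsomorphisms.

(** * Truncations of A and the valuation of x + A *)

Section Valuations.
Import Order.TTheory GRing.Theory Num.Theory.
Local Open Scope ring_scope.
Variable omega : nat -> bool.

(** The residue of A modulo 2^n. *)
Definition psum n : int := \sum_(i < n) (omega i)%:R * 2 ^+ i.

(* The 2-adic valuation of [x + A] is at least [n], where the 2-adic integer
   [A] has the binary digits [omega]. *)
Definition val_ge n (x : int) := (2 ^+ n %| x + psum n)%Z.

Definition val_eq n x := val_ge n x && ~~ val_ge n.+1 x.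

Lemma psumS n : psum n.+1 = psum n + (omega n)%:R * 2 ^+ n.
Proof. by rewrite /psum big_ord_recr. Qed.

Lemma psum_bound n : 0 <= psum n < 2 ^+ n.
Proof.
elim: n => [|n]; first by rewrite /psum big_ord0 expr0.
rewrite psumS exprS; case: (omega n); rewrite ?mul1r ?mul0r;
  move: (psum n) (2 ^+ n); lia.
Qed.

Lemma expr2_gt0 n : 0 < 2 ^+ n :> int.
Proof. exact: exprn_gt0. Qed.

Lemma val_ge0 x : val_ge 0 x.
Proof. by rewrite /val_ge expr0 dvd1z. Qed.

Lemma val_geW n x : val_ge n.+1 x -> val_ge n x.
Proof.
move=> /dvdzP[q]; rewrite psumS exprS => E; apply/dvdzP.
exists (2 * q - (omega n)%:R).
move: E; case: (omega n); move: (psum n) (2 ^+ n); lia.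
Qed.

Lemma val_ge_le m n x : (m <= n)%N -> val_ge n x -> val_ge m x.
Proof.
elim: n => [|n IHn]; first by rewrite leqn0 => /eqP ->.
by rewrite leq_eqVlt ltnS => /orP[/eqP -> //|/IHn H /val_geW].
Qed.

(** The valuation is n exactly when x + A is congruent to 2^n modulo 2^(n+1), and
    [offset omega n.+1] is [psum n.+1] minus this 2^n. *)
Lemma val_eq_offset n x : val_eq n x = (2 ^+ n.+1 %| x + offset omega n.+1)%Z.
Proof.
rewrite /val_eq /val_ge /offset -/(psum n.+1) psumS exprS /=.
move: (psum n) (omega n) (expr2_gt0 n) => s b; move: (2 ^+ n : int) => p p0.
have p0' : p != 0 by lia.
have dvd2p k : (2 * p %| k * p)%Z = (2 %| k)%Z by rewrite dvdz_mul2r.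
apply/idP/idP.
  move=> /andP[/dvdzP[k xk]].
  have -> : x + (s + b%:R * p) = (k + b%:R) * p by rewrite mulrDl -xk addrA.
  have -> : x + (s + b%:R * p - p) = (k + b%:R - 1) * p.
    by rewrite mulrBl mulrDl mul1r -xk !addrA.
  rewrite !dvd2p; lia.
move=> /dvdzP[q E].
have xk : x + s = (2 * q + 1 - b%:R) * p.
  by case: (b) E; lia.
apply/andP; split; first by apply/dvdzP; exists (2 * q + 1 - b%:R).
have -> : x + (s + b%:R * p) = (2 * q + 1) * p.
  by rewrite addrA xk -mulrDl subrK.
rewrite dvd2p; lia.
Qed.

Lemma val_eq_uniq m n x : val_eq m x -> val_eq n x -> m = n.
Proof.
move=> /andP[m1 m2] /andP[n1 n2].
by case: (ltngtP m n) => // /val_ge_le; [move/(_ _ n1); rewrite (negbTE m2)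
  |move/(_ _ m1); rewrite (negbTE n2)].
Qed.

Lemma val_geP n x : val_ge n x <-> forall m, (m < n)%N -> ~~ val_eq m x.
Proof.
split=> [xn m mn|]; first by rewrite /val_eq (val_ge_le mn xn) andbF.
elim: n => [_|n IHn H]; first exact: val_ge0.
have := H _ (ltnSn n); rewrite /val_eq IHn; first by rewrite negbK.
by move=> m mn; apply: H; exact: ltnW.
Qed.

Lemma val_ge_dvd n x y : val_ge n x -> val_ge n y = (2 ^+ n %| y - x)%Z.
Proof.
rewrite /val_ge => xn; have -> : y + psum n = (y - x) + (x + psum n) by lia.
by rewrite rpredDr.
Qed.

Lemma val_ge_shift n x y : (2 ^+ n %| y - x)%Z -> val_ge n y = val_ge n x.
Proof.
rewrite /val_ge => xy; have -> : y + psum n = (y - x) + (x + psum n) by lia.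
by rewrite rpredDl.
Qed.

Lemma val_eq_shift n x y :
  (2 ^+ n.+1 %| y - x)%Z -> val_eq n y = val_eq n x.
Proof.
move=> xy; rewrite /val_eq (val_ge_shift xy) (@val_ge_shift n x y) //.
by apply: dvdz_trans xy; rewrite exprS dvdz_mull.
Qed.

(** * Edges in terms of valuations *)

Lemma level_edgeE n x y :
  level_edge omega n.+1 x y <-> val_eq n x /\ y = x + 2 ^+ n.+1.
Proof.
rewrite val_eq_offset /=; split.
  move=> [z [-> ->]]; rewrite subrK dvdz_mulr ?dvdzz //; split => //.
  by rewrite mulrDr mulr1 addrAC.
move=> [/dvdzP[q E] ->]; exists q.
by rewrite mulrDr mulr1 [_ * q]mulrC -E; split; rewrite ?addrK // addrAC addrK.
Qed.

Lemma norm_eqP (a b p : int) : 0 < p ->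
  `|a - b| = p <-> b = a + p \/ a = b + p.
Proof. lia. Qed.

(** A shift by 2^(n+1) does not change whether the valuation is n, so the condition may be read at
    either end. *)
Lemma level_edge_norm n x y :
  level_edge omega n.+1 x y \/ level_edge omega n.+1 y x <->
  val_eq n x /\ `|x - y| = 2 ^+ n.+1.
Proof.
have E (a b : int) : `|a - b| = 2 ^+ n.+1 <-> b = a + 2 ^+ n.+1 \/ a = b + 2 ^+ n.+1.
  exact: norm_eqP (expr2_gt0 _).
rewrite !level_edgeE E; split=> [[[vx ->]|[vy ->]]|[vx [->|xy]]].
- by split; [|left].
- split; last by right.
  by rewrite (@val_eq_shift n y) // addrC addKr dvdzz.
- by left.
- by right; split => //; rewrite -(@val_eq_shift n y x) // xy addrC addKr dvdzz.
Qed.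

Lemma covered_val x : covered omega x <-> exists n, val_eq n x.
Proof.
split=> [[[|n] [u [//= _]]]|[n xn]].
  by rewrite or_comm => /level_edge_norm[xn _]; exists n.
exists n.+1, (x + 2 ^+ n.+1); split => //; right.
exact/level_edgeE.
Qed.

Lemma X_adjE (x y : int) : @adj (X omega) x y <->
  [\/ `|x - y| = 1, exists2 n, val_eq n x & `|x - y| = 2 ^+ n.+1
    | x = y /\ forall n, val_ge n x].
Proof.
split.
  case=> [[[|n]]|[xy ncov]].
  - by move=> /= [[z [-> ->]]|[z [-> ->]]]; constructor 1; lia.
  - by move=> /level_edge_norm[xn xy]; constructor 2; exists n.
  constructor 3; split => // n; apply/val_geP => m _; apply/negP => xm.
  by apply: ncov; rewrite -xy; apply/covered_val; exists m.
case=> [xy|[n xn xy]|[xy vx]].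
- left; exists 0%N => /=.
  have [->|->] : y = x + 1 \/ x = y + 1 by lia.
    by left; exists x.
  by right; exists y.
- by left; exists n.+1; apply/level_edge_norm.
- right; split => //; rewrite -xy => /covered_val[n]; apply/negP.
  by move/val_geP: (vx n.+1); apply.
Qed.

Lemma unit_adj (x y : int) : `|x - y| = 1 -> @adj (X omega) x y.
Proof. by move=> xy; apply/X_adjE; constructor 1. Qed.

(** Edges of different levels have different lengths and loops have length 0, so the length
    determines the level. *)
Lemma X_adj_pow n (x y : int) : `|x - y| = 2 ^+ n.+1 ->
  @adj (X omega) x y <-> val_eq n x.
Proof.
move=> xyn; have n2 : 1 < 2 ^+ n.+1 :> int by rewrite exprn_egt1.
split=> [/X_adjE[xy1|[m xm]|[xy _]]|xn].
- by move: n2; rewrite -xyn xy1.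
- have inj2 : injective (GRing.exp (2 : int)) by apply: ieexprIn.
  by rewrite xyn => /inj2[->].
- by move: n2; rewrite -xyn xy subrr normr0.
- by apply/X_adjE; constructor 2; exists n.
Qed.

(** * Triangles and the recognition of edges of length 1 *)

Lemma val_eq0 x : val_eq 0 x = ~~ val_ge 1 x.
Proof. by rewrite /val_eq val_ge0. Qed.

Lemma val_ge1 x y : val_ge 1 x = val_ge 1 y <-> (2 %| x - y)%Z.
Proof. by rewrite /val_ge expr1; split; lia. Qed.

Lemma adj_near (x y : int) : @adj (X omega) x y -> x <> y ->
  [\/ `|x - y| = 1, `|x - y| = 2 /\ ~~ val_ge 1 x
    | val_ge 1 x /\ exists n, [/\ val_eq n x, `|x - y| = 2 ^+ n.+1
                               & 4 <= `|x - y|]].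
Proof.
move=> /X_adjE[xy1|[[|n] xn xyn]|[-> _ //]] _.
- by constructor 1.
- by rewrite -val_eq0; constructor 2.
constructor 3; split; first by case/andP: xn => xn _; exact: val_ge_le xn.
exists n.+1; split => //; rewrite xyn !exprS.
by move: (expr2_gt0 n); move: (2 ^+ n); lia.
Qed.

(* An edge longer than 2 joins vertices of the same valuation n >= 1, so a triangle on
   it would have all three sides of length 2^(n+1), which is impossible. *)
Lemma tri_near (x y : int) : @tri (X omega) x y <->
  `|x - y| = 1 \/ `|x - y| = 2 /\ ~~ val_ge 1 x.
Proof.
split.
  move=> [xy axy [z [zx zy xz yz]]].
  have [|?|[x1 [n [xn xyn xy4]]]] := adj_near axy xy; [by left|by right|].
  have [|[xz2]|[_ [m [xm xzm xz4]]]] := adj_near xz (nesym zx); last first.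
  - have yn : val_eq n y.
      rewrite -(@val_eq_shift n y x) //.
      have [->|->] : x - y = 2 ^+ n.+1 \/ x - y = - 2 ^+ n.+1.
        by move: xyn; move: (2 ^+ n.+1); lia.
        by rewrite dvdzz.
      by rewrite rpredN dvdzz.
    have mn := val_eq_uniq xm xn; subst m.
    (* As z differs from y, the two lie on opposite sides of x at distance 2^(n+2), while edges at y
       have length 1 or 2^(n+1). *)
    have [yz1|[yz2 _]|[_ [m [ym yzm yz4]]]] := adj_near yz (nesym zy).
    + by move: xyn xzm xy4 zy; move: (2 ^+ n.+1); lia.
    + by move: xyn xzm xy4 zy; move: (2 ^+ n.+1); lia.
    + have mn := val_eq_uniq ym yn; subst m.
      by move: xyn xzm yzm xy4; move: (2 ^+ n.+1); lia.
  - by rewrite x1.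
  - move=> xz1; have [|[yz2 _]|[_ [m [ym yzm yz4]]]] := adj_near yz (nesym zy).
    + lia.
    + lia.
    (* Parity: x - y and y - z are even, but x - z is odd. *)
    + by move: xyn yzm; rewrite !exprS; move: (2 ^+ n) (2 ^+ m); lia.
have adj2 (a b : int) : `|a - b| = 2 -> ~~ val_ge 1 a -> @adj (X omega) a b.
  by move=> ab; rewrite -val_eq0 => a0; apply/(@X_adj_pow 0).
case=> [xy1|[xy2 xodd]].
  split; [by move=> E; move: xy1; rewrite E subrr|exact: unit_adj|].
  (* One of x + A, y + A is even; the third vertex is the reflection of the other endpoint in the
     even one. *)
  have [xev|xodd] := boolP (val_ge 1 x).
    exists (2 * x - y); split; [lia|lia|apply: unit_adj; lia|apply: adj2; first lia].
    by apply/negP => yev; have /val_ge1 := etrans xev (esym yev); lia.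
  exists (2 * y - x); split; [lia|lia|apply: adj2 => //; lia|apply: unit_adj; lia].
split; [by move=> E; move: xy2; rewrite E subrr|exact: adj2|].
have [E|E] : y = x + 2 \/ y = x - 2 by lia.
  by exists (x + 1); split; [lia|lia|apply: unit_adj; lia|apply: unit_adj; lia].
by exists (x - 1); split; [lia|lia|apply: unit_adj; lia|apply: unit_adj; lia].
Qed.

(** If x + A is odd, all edges at x have length 1 or 2 and lie in triangles. If it is even, the
    witness is the far end of a long edge, or x itself when x = - A, since [tri] excludes loops. *)
Lemma spike_val (x : int) : @spike (X omega) x <-> val_ge 1 x.
Proof.
split=> [[t xt ntri]|xev].
  apply/negPn/negP => xodd; apply: ntri.
  have xt' : x <> t.
    move=> E; move: xt; rewrite -E => /X_adjE; rewrite subrr normr0.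
    case=> [//|[n _ n0]|[_ /(_ 1%N)]]; last exact/negP.
    by have := expr2_gt0 n.+1; rewrite -n0.
  apply/tri_near; have [?|[? _]|[xev]] := adj_near xt xt'; [by left|by right|].
  by rewrite xev in xodd.
have [[n xn]|nval] := pselect (exists n, val_eq n x).
  exists (x + 2 ^+ n.+1).
    apply/(@X_adj_pow n) => //.
    by apply/norm_eqP; [exact: expr2_gt0|left].
  case: n xn => [|n xn]; first by rewrite val_eq0 xev.
  move=> /tri_near; rewrite !exprS.
  by move: (expr2_gt0 n); move: (2 ^+ n); lia.
exists x; last by case.
apply/X_adjE; constructor 3; split => // n; apply/val_geP => m _.
by apply/negP => xm; apply: nval; exists m.
Qed.

(** A triangle edge of length 2 has both ends odd relative to A, whereas an edge of length 1 has an
    even end. *)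
Lemma unit_step (x y : int) :
  @tri (X omega) x y /\ (@spike (X omega) x \/ @spike (X omega) y) <->
  `|x - y| = 1.
Proof.
rewrite !spike_val; split=> [[/tri_near[//|[xy2 xodd]]]|xy1].
  have yx : val_ge 1 y = val_ge 1 x by apply/val_ge1; lia.
  by rewrite yx => -[]; rewrite (negbTE xodd).
split; first by apply/tri_near; left.
case: (boolP (val_ge 1 x)) => xev; first by left.
case: (boolP (val_ge 1 y)) => yev; first by right.
have /val_ge1 : val_ge 1 x = val_ge 1 y by rewrite (negbTE xev) (negbTE yev).
lia.
Qed.

(** * Isomorphisms of balls are affine near the centre *)

Lemma ball_set_int k (u x : int) : `|x - u| <= k%:Z ->
  @ball_set (X omega) u k x.
Proof.
elim: k x => [|k IHk] x xu.
  by apply/ball_setP; exists 0%N => //=; lia.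
have [xu'|xu'] := lerP `|x - u| k%:Z; first exact: ball_set_le (leqnSn k) (IHk _ xu').
have [xu1|xu1] := lerP u x.
  by apply: (@ball_set_step (X omega) u k (x - 1)); [apply: IHk|apply: unit_adj]; lia.
by apply: (@ball_set_step (X omega) u k (x + 1)); [apply: IHk|apply: unit_adj]; lia.
Qed.

(** On the interval around u the map sends unit steps to unit steps and is injective, so it never
    turns back. *)
Lemma ball_map_affine (u v : int) r g : @ball_map (X omega) u v r.+1 g ->
  exists2 e : int, e = 1 \/ e = -1 &
  forall x, `|x - u| <= r%:Z -> g x = v + e * (x - u).
Proof.
move=> gP; have [gu ginj _ _ _] := gP.
pose h : int -> int := g.
have gstep (x y : int) : `|x - u| <= r%:Z -> `|y - u| <= r%:Z ->
    `|x - y| = 1 -> `|h x - h y| = 1.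
  move=> /ball_set_int ux /ball_set_int uy /unit_step[txy sxy].
  apply/unit_step; split.
    exact: (proj1 (ball_map_tri gP ux (ball_set_le (leqnSn r) uy)) txy).
  by case: sxy => [/(ball_map_spike gP ux)|/(ball_map_spike gP uy)]; [left|right].
have gneq (x y : int) : `|x - u| <= r%:Z -> `|y - u| <= r%:Z -> x <> y ->
    h x <> h y.
  move=> /ball_set_int ux /ball_set_int uy xy /ginj H; apply/xy/H.
    exact: ball_set_le (leqnSn r) ux.
  exact: ball_set_le (leqnSn r) uy.
(* The direction is read off at u + 1, whose image is v + 1 or v - 1 as soon as r is positive. *)
pose e : int := if h (u + 1) == v + 1 then 1 else -1.
have e1 : e = 1 \/ e = -1 by rewrite /e; case: ifP; [left|right].
exists e => //.
have gu0 : h u = v by [].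
have main k : (k <= r)%N ->
    h (u + k%:Z) = v + e * k%:Z /\ h (u - k%:Z) = v - e * k%:Z.
  (* Two-step induction: the image of the next point is adjacent to the last image and differs from
     the one before it. *)
  elim/ltn_ind: k => -[|[|k]] IH kr.
  - by rewrite addr0 mulr0 addr0 ?subr0.
  - have := gstep (u + 1) u; have := gstep (u - 1) u; have := gneq (u + 1) (u - 1).
    rewrite gu0 /e; move: (h (u + 1)) (h (u - 1)) => a b; case: eqP; lia.
  - have [E1 E2] := IH k.+1 (ltnSn _) (ltnW kr).
    have [F1 F2] := IH k (ltnW (ltnSn _)) (ltnW (ltnW kr)).
    have := gstep (u + k.+2%:Z) (u + k.+1%:Z).
    have := gstep (u - k.+2%:Z) (u - k.+1%:Z).
    have := gneq (u + k.+2%:Z) (u + k%:Z).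
    have := gneq (u - k.+2%:Z) (u - k%:Z).
    rewrite E1 E2 F1 F2; move: (h _) (h _) => a b; case: e1 => ->; lia.
move=> x xu; rewrite -/(h x); have [xu1|xu1] := lerP u x.
  have [|E _] := main `|x - u|%N; first lia.
  have xuE : x - u = `|x - u|%N by lia.
  by rewrite xuE -E; congr (h _); lia.
have [|_ E] := main `|x - u|%N; first lia.
have -> : v + e * (x - u) = v - e * `|x - u|%N by case: e1 => ->; lia.
by rewrite -E; congr (h _); lia.
Qed.

(** * Integrality of A and genericity *)

Lemma lt_expr2 n (a : int) : (`|a| <= n)%N -> `|a| < 2 ^+ n.
Proof.
move=> an; have := ltn_expl n (isT : 1 < 2)%N.
by rewrite -(ltr_nat int) natrX; lia.
Qed.

Lemma dvdz_lt_eq0 (p b : int) : (p %| b)%Z -> `|b| < p -> b = 0.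
Proof.
move=> /dvdzP[q ->] qp; have p0 : 0 < p by exact: le_lt_trans qp.
move: qp; rewrite normrM (gtr0_norm p0) gtr_pMl // => q1.
by rewrite (_ : q = 0) ?mul0r //; lia.
Qed.

Lemma expr2_dvd_eq0 (a : int) : (forall n, (2 ^+ n %| a)%Z) -> a = 0.
Proof. by move=> /(_ `|a|%N) /dvdz_lt_eq0; apply; exact: lt_expr2. Qed.

(* A map x |-> v + (x - u) preserving all valuations would force u = v, and
   x |-> v - (x - u) would force 2 A = - (u + v) and hence A to be an integer;
   both follow by evaluating at integers x close to - A. *)
Lemma val_separates (e u v : int) : e = 1 \/ e = -1 -> u <> v ->
  ~ (exists a, forall n, val_ge n a) ->
  exists x n, val_eq n x <> val_eq n (v + e * (x - u)).
Proof.
move=> e1 uv nint; apply: contrapT => nsep.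
have H x n : val_ge n x = val_ge n (v + e * (x - u)).
  have E m : val_eq m x = val_eq m (v + e * (x - u)).
    by apply: contrapT => E; apply: nsep; exists x, m.
  by apply/idP/idP => /val_geP V; apply/val_geP => m mn; move: (V m mn); rewrite E.
have psum_ge n : val_ge n (- psum n) by rewrite /val_ge addNr dvdz0.
case: e1 => ee; subst e.
  apply: uv; apply/eqP; rewrite eq_sym -subr_eq0; apply/eqP/expr2_dvd_eq0 => n.
  have := psum_ge n; rewrite H (val_ge_dvd _ (psum_ge n)).
  by congr (_ %| _)%Z; lia.
have D n : (2 ^+ n %| (u + v) + 2 * psum n)%Z.
  have := psum_ge n; rewrite H (val_ge_dvd _ (psum_ge n)).
  by congr (_ %| _)%Z; lia.
have [b ub] : exists b, u + v = 2 * b.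
  exists ((u + v) %/ 2)%Z; have := D 1%N; rewrite expr1; lia.
(* Cancelling a factor 2 costs one level, hence n + 1; modulo 2^n, [psum n.+1] agrees with
   [psum n]. *)
apply: nint; exists b => n; have := D n.+1.
by rewrite ub -mulrDr exprS dvdz_mul2l // psumS addrA rpredDr // dvdz_mull ?dvdzz.
Qed.

(** Here a = - A. For large n the bounds on [psum n] force it to be - a if a <= 0 and 2^n - a if a >
    0, so the digits end in 0s or 1s respectively. Conversely, a tail of digits b from N on gives -
    A = b 2^N - [psum N] by a geometric sum. *)
Lemma val_ge_all_digits : (exists a, forall n, val_ge n a) <->
  exists b N, forall i, (N <= i)%N -> omega i = b.
Proof.
split=> [[a av]|[b [N omegaN]]].
  have [a0|a0] := lerP a 0.
    have psumE n : (`|a| <= n)%N -> psum n = - a.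
      move=> /lt_expr2 an; have bn := psum_bound n.
      by have /dvdz_lt_eq0 := av n; lia.
    exists false, `|a|%N => i ai; have := psumS i; rewrite !psumE //; last exact: leqW.
    by have := expr2_gt0 i; case: (omega i); rewrite ?mul1r //; move: (2 ^+ i); lia.
  have psumE n : (`|a| <= n)%N -> psum n = 2 ^+ n - a.
    move=> /lt_expr2 an; have bn := psum_bound n.
    have /dvdz_lt_eq0 : (2 ^+ n %| a + psum n - 2 ^+ n)%Z.
      by rewrite rpredB ?dvdzz //; exact: av.
    lia.
  exists true, `|a|%N => i ai; have := psumS i; rewrite !psumE //; last exact: leqW.
  by have := expr2_gt0 i; rewrite exprS; case: (omega i); rewrite ?mul0r //; move: (2 ^+ i); lia.
have psumE n : psum (N + n) = psum N + b%:R * (2 ^+ (N + n) - 2 ^+ N).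
  elim: n => [|n IHn]; first by rewrite addn0 subrr mulr0 addr0.
  rewrite addnS psumS IHn omegaN ?leq_addr // exprS; case: b {omegaN IHn};
    move: (psum N) (2 ^+ _) (2 ^+ _); lia.
exists (b%:R * 2 ^+ N - psum N) => n; apply: (@val_ge_le n (N + n)); first exact: leq_addl.
apply/dvdzP; exists b%:R; rewrite psumE.
case: b {omegaN psumE}; move: (psum N) (2 ^+ _) (2 ^+ _); lia.
Qed.

(* If - A is an integer a, the reflection x |-> 2 a - x is an automorphism. *)
Lemma generic_X : generic (X omega) <-> ~ (exists a, forall n, val_ge n a).
Proof.
split=> [gen [a av]|nint u v uv].
  have val_reflect n x : val_ge n (2 * a - x) = val_ge n x.
    rewrite !(val_ge_dvd _ (av n)) (_ : 2 * a - x - a = - (x - a)); last lia.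
    by rewrite rpredN.
  have neq : a - 1 <> a + 1 by lia.
  (* The reflection exchanges a - 1 and a + 1, so their balls are isomorphic for every radius. *)
  have [r] := gen (a - 1) (a + 1) neq; apply; apply/rtype_eqP.
  have -> : a + 1 = 2 * a - (a - 1) by lia.
  apply: (@involution_ball_iso (X omega) (fun x : int => 2 * a - x)).
    by move=> x; lia.
  move=> x y /X_adjE xy; apply/X_adjE.
  have -> : `|2 * a - x - (2 * a - y)| = `|x - y| by lia.
  case: xy => [?|[n xn ?]|[-> vy]]; first by constructor 1.
    by constructor 2; exists n => //; rewrite /val_eq !val_reflect.
  by constructor 3; split => // n; rewrite val_reflect.
have [x1 [n1 sep1]] := val_separates (or_introl erefl) uv nint.
have [x2 [n2 sep2]] := val_separates (or_intror erefl) uv nint.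
(* The sign e is known only after the radius is fixed, so R covers the separating points for both
   signs, with their edges of length 2^(n1+1) and 2^(n2+1). *)
pose R : int := `|x1 - u| + 2 ^+ n1.+1 + (`|x2 - u| + 2 ^+ n2.+1).
exists `|R|%N.+1 => /rtype_eqP /ball_iso_map[g gP].
have [e e1 gE] := ball_map_affine gP; have [_ _ gadj _ _] := gP.
(* The affine map preserves the distance between x and x + 2^(n+1), and adjacency at this distance
   means valuation n. *)
have gval n x : `|x - u| + 2 ^+ n.+1 <= R ->
    val_eq n x = val_eq n (v + e * (x - u)).
  move=> xR; have p0 := expr2_gt0 n.+1; set p : int := 2 ^+ n.+1 in xR p0.
  have xu : `|x - u| <= `|R|%N%:Z by lia.
  have yu : `|x + p - u| <= `|R|%N%:Z by lia.
  have xy : `|x - (x + p)| = p by lia.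
  have gxy : `|v + e * (x - u) - (v + e * (x + p - u))| = p by case: e1 => ->; lia.
  have /(_ x (x + p)) := gadj.
  move/(_ (ball_set_le (leqnSn _) (ball_set_int xu))).
  move/(_ (ball_set_le (leqnSn _) (ball_set_int yu))).
  rewrite !gE // (X_adj_pow xy) (X_adj_pow gxy) => H.
  by apply/idP/idP => /H.
have p1 := expr2_gt0 n1.+1; have p2 := expr2_gt0 n2.+1.
case: e1 => ee; subst e; [apply: sep1|apply: sep2]; apply: gval; rewrite /R.
  by rewrite lerDl; apply: addr_ge0 => //; exact: ltW.
by rewrite lerDr; apply: addr_ge0 => //; exact: ltW.
Qed.

End Valuations.

(** * From eventually constant digits to infinite sets of indices *)

Lemma finite_set_natP (A : set nat) :
  finite_set A <-> exists N, forall i, (N <= i)%N -> ~ A i.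
Proof.
split=> [/finite_seqP[s ->]|[N AN]].
  exists (\max_(i <- s) i).+1 => i si /= /(@leq_bigmax_seq _ _ xpredT id).
  by move=> /(_ isT); rewrite leqNgt => /negP; apply.
apply: (@sub_finite_set _ _ `I_N); last exact: finite_II.
by move=> i Ai /=; rewrite ltnNge; apply/negP => /AN.
Qed.

Theorem mainTheorem5 (omega : nat -> bool) :
  generic (X omega) <->
  infinite_set [set i | omega i = false] /\ infinite_set [set i | omega i = true].
Proof.
rewrite generic_X val_ge_all_digits; split=> [H|[H0 H1] [b [N omegaN]]].
  split=> /finite_set_natP[N omegaN]; apply: H.
    by exists true, N => i /omegaN /=; case: (omega i).
  by exists false, N => i /omegaN /=; case: (omega i).
case: b omegaN => omegaN; [apply: H0|apply: H1]; apply/finite_set_natP;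
  by exists N => i /omegaN /= ->.
Qed.
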